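(* Let $N\ge 2$ be an integer, let $s,r$ be real numbers with $0<s\leq r<\frac12$, and let $0<\eta<1$. Let $f,g,h:\mathbb{N}\to\mathbb{N}$ be functions such that for every $n\in\mathbb{N}$ \[ 1\leq f(n),\quad 1\le g(n)^{1/s},\quad 1\le h(n)^{1/r},\qquad f(n),\ g(n)^{1/s},\ h(n)^{1/r}\leq N^{(2-\eta)^n}, \] and $N^{s2^n}g(n)\leq N^{r2^n}h(n)$. For each $n\in\mathbb{N}$ define \[ a_n=N^{2^n}f(n),\qquad m_n=\lfloor N^{s2^n}g(n)\rfloor, \] and let $\mathbb{D}_n=\{1=d_{n,1}<d_{n,2}<\dots<d_{n,m_n}\}\subset\mathbb{N}$ be any set of $m_n$ positive integers with smallest element $1$ and largest element $d_{n,m_n}\leq N^{r2^n}h(n)$. Let \[ \mathcal{K}=\left\{\sum_{n=1}^{\infty}\frac{1}{d_n a_n} : d_n\in\mathbb{D}_n\text{ for every } n\in\mathbb{N}\right\}. \] Then \[ \dim_{\mathcal{H}}(\mathcal{K})\geq \frac{s}{2-s}. \]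
   Context: $\dim_{\mathcal{H}}$ denotes Hausdorff dimension of a subset of $\mathbb{R}$. $\mathbb{N}=\{1,2,3,\dots\}$. The set $\mathcal{K}$ consists of all sums obtained as $(d_n)_{n\ge1}$ ranges over all sequences with $d_n\in\mathbb{D}_n$ for each $n$. *)

(* Defs.v *)
From mathcomp Require Import all_boot all_order all_algebra.
From mathcomp Require Import all_classical all_reals all_analysis.

Set Implicit Arguments.
Unset Strict Implicit.
Unset Printing Implicit Defensive.

Import Order.TTheory GRing.Theory Num.Theory.
Import numFieldNormedType.Exports.

Local Open Scope classical_set_scope.
Local Open Scope ring_scope.

(* The point 0 is adjoined so that the empty set has diameter 0. *)
Definition diam (R : realType) (A : set R) : \bar R :=
  ereal_sup (0%E |` [set (`|x - y|)%:E | x in A & y in A]).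

(* diam(A)^t, with the usual conventions that the empty set contributes 0 and
   a nonempty set contributes 1 when t = 0, even if it is a singleton. *)
Definition diam_pow (R : realType) (t : R) (A : set R) : \bar R :=
  if pselect (A = set0) then 0%E else (diam A `^ t)%E.

Definition hausdorff_content (R : realType) (t delta : R) (A : set R) :
    \bar R :=
  ereal_inf [set (\sum_(0 <= k <oo) diam_pow t (F k))%E |
    F in [set F : nat -> set R | A `<=` \bigcup_k F k /\
                                 forall k, (diam (F k) <= delta%:E)%E]].

(* As delta decreases to 0 the content increases, so the limit is a supremum. *)
Definition hausdorff_measure (R : realType) (t : R) (A : set R) : \bar R :=
  ereal_sup [set hausdorff_content t delta A | delta in [set e : R | 0 < e]].

Definition hausdorff_dim (R : realType) (A : set R) : \bar R :=
  ereal_inf [set t%:E | t in [set t : R | 0 <= t /\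
                                          hausdorff_measure t A = 0%E]].

(* Sequences are indexed by n >= 1: the values d 0, a 0 and D 0 are irrelevant. *)
Definition digit_sums (R : realType) (a : nat -> nat) (D : nat -> seq nat) :
    set R :=
  [set limn (fun M : nat =>
         \sum_(1 <= n < M) ((d n)%:R * (a n)%:R)^-1 : R) |
    d in [set d : nat -> nat | forall n, (1 <= n)%N -> d n \in D n]].

(* Main.v *)
Require Import Defs.
From mathcomp Require Import all_boot all_order all_algebra.
From mathcomp Require Import all_classical all_reals all_analysis.
From mathcomp Require Import ring lra zify.

(* Fix the first digits to be 1 and read x in [0, 1[ in the Cantor series with
   bases m_n; sending the n-th digit of x to an element of D_n, in decreasing
   order of D_n, gives an increasing map phi from [0, 1[ into K. Let x < y first
   differ at level n, by K = j - i >= 1 digits. Then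
     y - x <= 2 K / (m_1 ... m_n),
     phi y - phi x >= K G_n - (tail) >= K G_n / 2,  G_n = 1 / (a_n max(D_n)^2),
   because two elements d < d' of D_n give 1/d - 1/d' >= (d' - d) / max(D_n)^2
   and the tail, of order N^(-2^(n+1)), is negligible as 2 r < 1. With
   t = s / (2 - s) <= 1 and u = K / m_n <= 1 one has u <= u^t, so the Hoelder
   bound y - x <= C (phi y - phi x)^t follows from
   1 / (m_1 ... m_(n-1)) <= C (m_n G_n)^t, that is, up to lower-order terms
   bounded by (2 - eta)^n, from t (1 + 2 r - s) < t (2 - s) = s. A Hoelder inverse
   of exponent t forces dim K >= t. *)

Set Implicit Arguments.
Unset Strict Implicit.

Import Order.TTheory GRing.Theory Num.Theory.
Import numFieldNormedType.Exports.

Local Open Scope ring_scope.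

(** * Dimension bound from a Hoelder inverse *)

Lemma diam_ge0 (R : realType) (A : set R) : (0 <= diam A)%E.
Proof. by apply: ereal_sup_ubound; left. Qed.

Lemma dist_le_diam (R : realType) (A : set R) (x y : R) :
  A x -> A y -> (`|x - y|%:E <= diam A)%E.
Proof. by move=> Ax Ay; apply: ereal_sup_ubound; right; exists x => //; exists y. Qed.

Lemma diam_pow_ge0 (R : realType) (t : R) (A : set R) : (0 <= diam_pow t A)%E.
Proof. by rewrite /diam_pow; by case: pselect => [?|?]; rewrite ?poweR_ge0. Qed.

(** For d <= 1 the larger exponent gives the smaller power. As t > 0, the left side vanishes on the
    empty set and on singletons, whatever [diam_pow] is there. *)
Lemma fine_diam_powR_le (R : realType) (t u : R) (A : set R) :
  0 <= u -> u < t -> (diam A <= 1)%E ->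
  ((fine (diam A) `^ t)%:E <= diam_pow u A)%E.
Proof.
move=> u0 ut dA1; rewrite /diam_pow; have t0 : 0 < t by lra.
case: pselect => [A0|_] /=.
  suff -> : diam A = 0%E by rewrite powR0// gt_eqF.
  apply/eqP; rewrite eq_le diam_ge0 andbT; apply: ge_ereal_sup => z [->//|].
  by rewrite A0; case=> x.
have : diam A \is a fin_num.
  by rewrite ge0_fin_numE ?diam_ge0// (le_lt_trans dA1)// ltry.
move=> _; have := diam_ge0 A; move: dA1; case: (diam A) => //= d.
rewrite !lee_fin => d1; rewrite le_eqVlt => /predU1P[<-|d0].
  by rewrite powR0 ?gt_eqF// powR_ge0.
by apply: ger_powR; [rewrite d0|exact: ltW].
Qed.

(* Lebesgue measure on [0, 1[ plays the role of a Frostman measure: a cover of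
   A by sets F k pulls back to a cover of [0, 1[ by intervals of length at most
   2 C diam(F k)^t. *)
Lemma hausdorff_dim_ge_holder (R : realType) (A : set R) (phi : R -> R)
    (t C : R) :
  0 < C -> (forall x, 0 <= x < 1 -> A (phi x)) ->
  (forall x y, 0 <= x -> x < y -> y < 1 -> y - x <= C * `|phi y - phi x| `^ t) ->
  (t%:E <= hausdorff_dim A)%E.
Proof.
move=> C0 Aphi hold; apply: le_ereal_inf_tmp => _ [u [u0 Hu0] <-].
rewrite lee_fin leNgt; apply/negP => ut.
suff : ((2 * C)^-1%:E <= hausdorff_measure u A)%E.
  by rewrite Hu0 lee_fin leNgt invr_gt0 mulr_gt0.
(* Scale 1 suffices: it gives [diam (F k) <= 1], as the passage from exponent t to u < t
   requires. *)
apply: (@le_trans _ _ (hausdorff_content u 1 A)); last first.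
  by apply: ereal_sup_ubound; exists 1 => //=.
apply: le_ereal_inf_tmp => _ [F [cov dF] <-].
pose L k := C * fine (diam (F k)) `^ t.
(* A base point of the preimage of [F k], 0 by default if that is empty. It may lie anywhere in the
   preimage, hence intervals of radius [L k] and the factor 2 in [2 * C]. *)
pose b k := xget 0 [set x | 0 <= x < 1 /\ F k (phi x)]%classic.
have L0 k : 0 <= L k by rewrite mulr_ge0 ?powR_ge0// ltW.
have LE k x y : 0 <= x < 1 -> F k (phi x) -> 0 <= y < 1 -> F k (phi y) ->
    x <= y -> y - x <= L k.
  move=> /andP[x0 _] Fx /andP[_ y1] Fy; rewrite le_eqVlt => /predU1P[->|xy].
    by rewrite subrr.
  apply: le_trans (hold _ _ x0 xy y1) _; rewrite ler_pM2l//.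
  apply: ge0_ler_powR; rewrite ?nnegrE ?fine_ge0 ?diam_ge0//; first exact: ltW (le_lt_trans u0 ut).
  have := dist_le_diam Fy Fx; have := dF k; have := diam_ge0 (F k).
  by case: (diam (F k)) => //= d _ _; rewrite lee_fin.
have cov01 : (`[0, 1[ `<=` \bigcup_k `[b k - L k, b k + L k])%classic.
  move=> x /=; rewrite in_itv/= => x01.
  have [k _ Fkx] := cov _ (Aphi _ x01); exists k => //=.
  have [/= b01 Fb] : [set x | 0 <= x < 1 /\ F k (phi x)]%classic (b k).
    by rewrite /b; case: xgetP => [y -> //|/(_ x)]; case.
  rewrite in_itv/=; have [xb|bx] := leP x (b k).
    by have := LE k _ _ x01 Fkx b01 Fb xb; have := L0 k; lra.
  by have := LE k _ _ b01 Fb x01 Fkx (ltW bx); have := L0 k; lra.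
have /= := measure_sigma_subadditive (@lebesgue_measure R)
  (fun k => measurable_itv `[b k - L k, b k + L k]) (measurable_itv `[0%R, 1%R[) cov01.
rewrite lebesgue_measure_itv/= lte_fin ltr01 sube0 => le1.
suff : (1 <= (2 * C)%:E * \sum_(0 <= k <oo) diam_pow u (F k))%E.
  by rewrite -lee_pdivrMl ?mulr_gt0// mule1.
rewrite -nneseriesZl; last by move=> ? _; exact: diam_pow_ge0.
apply: le_trans le1 _; apply: lee_nneseries => [k _ _|k _]; first exact: measure_ge0.
apply: (@le_trans _ _ (2 * L k)%:E).
  rewrite lebesgue_measure_itv/=; case: ifP => _.
    by rewrite -EFinD lee_fin; lra.
  by rewrite lee_fin mulr_ge0.
rewrite mulrA EFinM lee_pmul2l ?lte_fin ?mulr_gt0//.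
exact: fine_diam_powR_le.
Qed.

(** * Increasing lists and Cantor series *)

Lemma sorted_ltn_nth_gap (l : seq nat) (p q : nat) :
  sorted ltn l -> (p <= q)%N -> (q < size l)%N ->
  (nth 0%N l p + (q - p) <= nth 0%N l q)%N.
Proof.
move=> sl; elim: q => [|q IH] pq ql; first by move: pq; rewrite leqn0 => /eqP->; rewrite addn0.
move: pq; rewrite leq_eqVlt => /predU1P[->|pq]; first by rewrite subnn addn0.
have := IH pq (ltnW ql).
have := sorted_ltn_nth ltn_trans 0%N sl q q.+1 (ltnW ql) ql (ltnSn q).
rewrite /ltn/=; lia.
Qed.

Definition cantor_base (m : nat -> nat) (n : nat) : nat :=
  \prod_(1 <= k < n.+1) m k.

(** One integer that codes the first n digits of a point of [0, 1[. *)
Definition cantor_floor (R : realType) (m : nat -> nat) (n : nat) (x : R) : nat :=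
  Num.truncn ((cantor_base m n)%:R * x).

Definition cantor_digit (R : realType) (m : nat -> nat) (n : nat) (x : R) : nat :=
  (cantor_floor m n x %% m n)%N.

Lemma cantor_baseS (m : nat -> nat) (n : nat) :
  cantor_base m n.+1 = (cantor_base m n * m n.+1)%N.
Proof. by rewrite /cantor_base big_nat_recr. Qed.

Lemma cantor_base_gt0 (m : nat -> nat) (n : nat) :
  (forall k, (1 <= k)%N -> (0 < m k)%N) -> (0 < cantor_base m n)%N.
Proof.
move=> m0; elim: n => [|n IH]; first by rewrite /cantor_base big_geq.
by rewrite cantor_baseS muln_gt0 IH m0.
Qed.

(** Dividing by the last base drops the last digit. *)
Lemma cantor_floorS (R : realType) (m : nat -> nat) (n : nat) (x : R) :
  (0 < m n.+1)%N -> 0 <= x ->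
  (cantor_floor m n.+1 x %/ m n.+1)%N = cantor_floor m n x.
Proof.
move=> m0 x0; rewrite /cantor_floor cantor_baseS; set P := cantor_base m n.
have Px0 : 0 <= P%:R * x by rewrite mulr_ge0.
have mPx0 : 0 <= (P * m n.+1)%N%:R * x by rewrite mulr_ge0.
have m0' : 0 < (m n.+1)%:R :> R by rewrite ltr0n.
have /andP[lo hi] := truncn_itv Px0.
apply/eqP; rewrite eqn_leq -ltnS ltn_divLR// leq_divRL//.
rewrite truncn_lt_nat// truncn_ge_nat// !natrM.
rewrite (_ : P%:R * (m n.+1)%:R * x = P%:R * x * (m n.+1)%:R); last by ring.
by rewrite ltr_pM2r// ler_pM2r// lo hi.
Qed.

(** Take the least level at which the floors differ. The floors one level lower agree, so the
    difference is that of the digits, K >= 1, and the scaled distance is below K + 1 <= 2 K. *)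
Lemma cantor_first_difference (R : realType) (m : nat -> nat) (x y : R) :
  (forall k, (1 <= k)%N -> (0 < m k)%N) ->
  (forall B : nat, exists n, (B <= cantor_base m n)%N) ->
  0 <= x -> x < y -> y < 1 ->
  exists n, [/\ (forall k, (1 <= k <= n)%N -> cantor_digit m k x = cantor_digit m k y),
    (cantor_digit m n.+1 x < cantor_digit m n.+1 y)%N &
    (cantor_base m n.+1)%:R * (y - x) <=
      2 * (cantor_digit m n.+1 y - cantor_digit m n.+1 x)%N%:R].
Proof.
move=> m0 unb x0 xy y1; have y0 : 0 <= y by lra.
have : exists n, cantor_floor m n x != cantor_floor m n y.
  have [n Bn] := unb (Num.truncn (y - x)^-1).+1; exists n.
  apply/negP => /eqP; rewrite /cantor_floor => qE.
  have [P0 P0'] : 0 <= (cantor_base m n)%:R * x /\ 0 <= (cantor_base m n)%:R * y.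
    by rewrite !mulr_ge0.
  have /andP[_ +] := truncn_itv P0'; rewrite -qE.
  have /andP[+ _] := truncn_itv P0.
  have : 1 < (cantor_base m n)%:R * (y - x).
    rewrite -ltr_pdivrMr ?subr_gt0// mul1r (lt_le_trans (truncnS_gt _))//.
    by rewrite ler_nat.
  rewrite -natr1; lra.
move=> /ex_minnP[[|n] qne qmin].
  (* Level 0 separates nothing: both floors are 0 on [0, 1[. *)
  move: qne; rewrite /cantor_floor /cantor_base big_geq// !mul1r.
  have t0 (z : R) : 0 <= z < 1 -> Num.truncn z = 0%N.
    by move=> /andP[z0 z1]; apply/eqP; rewrite truncn_eq// mulr0n z0.
  by rewrite !t0 ?eqxx //; lra.
have qE k : (k <= n)%N -> cantor_floor m k x = cantor_floor m k y.
  by move=> kn; apply/eqP/negPn/negP => /qmin; rewrite ltnNge kn.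
have le_q : (cantor_floor m n.+1 x <= cantor_floor m n.+1 y)%N.
  by apply: le_truncn; rewrite ler_wpM2l// ltW.
have Dq : (cantor_floor m n.+1 y - cantor_floor m n.+1 x =
    cantor_digit m n.+1 y - cantor_digit m n.+1 x)%N.
  rewrite /cantor_digit (divn_eq (cantor_floor m n.+1 x) (m n.+1)).
  rewrite [X in (X - _)%N](divn_eq (cantor_floor m n.+1 y) (m n.+1)).
  by rewrite !cantor_floorS ?m0// qE// subnDl !modnMDl !modn_mod.
have lt_q : (0 < cantor_floor m n.+1 y - cantor_floor m n.+1 x)%N.
  by rewrite subn_gt0 ltn_neqAle qne.
exists n; split.
- by move=> k /andP[_ kn]; rewrite /cantor_digit qE.
- by rewrite -subn_gt0 -Dq.
rewrite -Dq.
have P0 : 0 <= (cantor_base m n.+1)%:R * x by rewrite mulr_ge0.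
have P0' : 0 <= (cantor_base m n.+1)%:R * y by rewrite mulr_ge0.
have /andP[+ _] := truncn_itv P0; have /andP[_ +] := truncn_itv P0'.
rewrite -/(cantor_floor m n.+1 x) -/(cantor_floor m n.+1 y).
have : (1 : R) <= (cantor_floor m n.+1 y - cantor_floor m n.+1 x)%N%:R by rewrite ler1n.
rewrite natrB// -natr1; lra.
Qed.

(** * The coding map and its Hoelder inverse *)

Section DigitSums.
(** [w] majorises 1 / a_n and at least halves at each step, so a tail is at most twice its first
    term. *)
Variables (R : realType) (a : nat -> nat) (D : nat -> seq nat) (w : nat -> R).
Hypotheses (a0 : forall n, (1 <= n)%N -> (0 < a n)%N)
  (w_ge : forall n, (1 <= n)%N -> (a n)%:R^-1 <= w n)
  (w_half : forall n, (1 <= n)%N -> 2 * w n.+1 <= w n).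

Lemma w_ge0 n : (1 <= n)%N -> 0 <= w n.
Proof. by move=> n1; rewrite (le_trans _ (w_ge n1))// invr_ge0. Qed.

Lemma sum_w_tail n M : (1 <= n)%N -> \sum_(n <= k < M) w k <= 2 * w n.
Proof.
move=> n1; have [nM|Mn] := leqP n M; last first.
  by rewrite big_geq ?mulr_ge0 ?w_ge0// ltnW.
(* The stronger bound telescopes: w_M <= 2 w_M - 2 w_(M+1). *)
suff : \sum_(n <= k < M) w k <= 2 * w n - 2 * w M.
  have := w_ge0 (leq_trans n1 nM); lra.
elim: M nM => [|M IH]; first by rewrite leqn0 => /eqP n0; rewrite n0 in n1.
rewrite leq_eqVlt => /predU1P[<-|nM]; first by rewrite big_geq// subrr.
rewrite big_nat_recr//=; have := IH nM; have := w_half (leq_trans n1 nM); lra.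
Qed.

Let term (d : nat) (n : nat) : R := (d%:R * (a n)%:R)^-1.

Lemma term_bounds d n : (1 <= n)%N -> (1 <= d)%N -> 0 <= term d n <= w n.
Proof.
move=> n1 d1; rewrite invr_ge0 mulr_ge0//= (le_trans _ (w_ge n1))//.
rewrite lef_pV2 ?posrE ?mulr_gt0 ?ltr0n ?a0//.
by rewrite ler_peMl// ler1n.
Qed.

Lemma is_cvg_digit_sum (d : nat -> nat) :
  (forall n, (1 <= n)%N -> (1 <= d n)%N) ->
  cvgn (fun M => \sum_(1 <= n < M) term (d n) n).
Proof.
move=> d1; apply: nondecreasing_is_cvgn.
  apply/nondecreasing_seqP => -[|n]; first by rewrite !big_geq.
  by rewrite [leRHS]big_nat_recr//= lerDl; case/andP: (term_bounds (ltn0Sn n) (d1 _ (ltn0Sn n))).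
exists (2 * w 1%N) => _ [M _ <-]; apply: le_trans (sum_w_tail M (leqnn 1)).
by apply: ler_sum_nat => n /andP[n1 _]; case/andP: (term_bounds n1 (d1 _ n1)).
Qed.

Hypotheses (D_sorted : forall n, (1 <= n)%N -> sorted ltn (D n))
  (D_head : forall n, (1 <= n)%N -> head 0%N (D n) = 1%N).

Let m n := size (D n).
Let G n : R := ((last 0%N (D n))%:R ^+ 2 * (a n)%:R)^-1.

Lemma m_gt0 n : (1 <= n)%N -> (0 < m n)%N.
Proof. by move=> /D_head; rewrite /m; case: (D n). Qed.

Lemma nth_D_ge1 n i : (1 <= n)%N -> (i < m n)%N -> (1 <= nth 0%N (D n) i)%N.
Proof.
move=> n1 im; have := sorted_ltn_nth_gap (D_sorted n1) (leq0n i) im.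
by rewrite nth0 D_head//; apply: leq_trans; rewrite leq_addr.
Qed.

(* The digits are read in decreasing order of D n, which makes the coding map
   increasing. *)
Let digit n (x : R) := nth 0%N (D n) ((m n).-1 - cantor_digit m n x).

Let phi (x : R) : R := limn (fun M => \sum_(1 <= n < M) term (digit n x) n).

Lemma digit_lt n (x : R) : (1 <= n)%N -> ((m n).-1 - cantor_digit m n x < m n)%N.
Proof. by move=> n1; have := m_gt0 n1; lia. Qed.

Lemma phi_digit_sums x : digit_sums a D (phi x).
Proof.
by exists (fun n => digit n x) => //= n n1; rewrite mem_nth// digit_lt.
Qed.

Lemma term_gap n p q : (1 <= n)%N -> (p < q)%N -> (q < m n)%N ->
  (q - p)%N%:R * G n <= term (nth 0%N (D n) p) n - term (nth 0%N (D n) q) n.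
Proof.
move=> n1 pq qm; have pm := ltn_trans pq qm.
have dp := nth_D_ge1 n1 pm; have dq := nth_D_ge1 n1 qm.
have := sorted_ltn_nth_gap (D_sorted n1) (ltnW pq) qm.
have qlast : (q <= (m n).-1)%N by lia.
have lastm : ((m n).-1 < m n)%N by rewrite prednK ?m_gt0.
have := sorted_ltn_nth_gap (D_sorted n1) qlast lastm.
rewrite nth_last => /(leq_trans (leq_addr _ _)) + gap; move: gap.
rewrite /G /term; move: (nth _ _ p) (nth _ _ q) (last _ _) dp dq => d e l d1 e1.
rewrite -(ler_nat R) natrD -(ler_nat R) => gap el.
have a0' : 0 < (a n)%:R :> R by rewrite ltr0n a0.
have d0 : 0 < d%:R :> R by rewrite ltr0n.
have e0 : 0 < e%:R :> R by rewrite ltr0n.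
have qp : 0 <= (q - p)%N%:R :> R by [].
have -> : (d%:R * (a n)%:R)^-1 - (e%:R * (a n)%:R)^-1 =
    (e%:R - d%:R) * (d%:R * e%:R * (a n)%:R)^-1 :> R.
  by field; rewrite !gt_eqF.
have de : d%:R <= e%:R :> R by lra.
have l0 : 0 < l%:R :> R by lra.
apply: ler_pM => //; first lra.
rewrite lef_pV2 ?posrE ?mulr_gt0 ?exprn_gt0//.
by rewrite ler_pM2r// expr2 ler_pM// ?(le_trans de).
Qed.

(** The terms before level n cancel, level n contributes the digit gap, and each later difference is
    at least -w_k. *)
Lemma phi_gap n (x y : R) : (1 <= n)%N ->
  (forall k, (1 <= k < n)%N -> cantor_digit m k x = cantor_digit m k y) ->
  (cantor_digit m n x < cantor_digit m n y)%N ->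
  (cantor_digit m n y - cantor_digit m n x)%N%:R * G n - 2 * w n.+1 <=
    phi y - phi x.
Proof.
move=> n1 eq_lt lt_n; have dig1 z k : (1 <= k)%N -> (1 <= digit k z)%N.
  by move=> k1; rewrite nth_D_ge1 ?digit_lt.
pose S z := fun M => \sum_(1 <= k < M) term (digit k z) k.
have cvS z : cvgn (S z) by exact: is_cvg_digit_sum (dig1 z).
have -> : phi y - phi x = limn (S y - S x) by rewrite limB.
apply: (limr_ge (is_cvgB (cvS y) (cvS x))).
near=> M; have nM : (n < M)%N by near: M; exists n.+1.
rewrite (_ : (S y - S x) M = S y M - S x M)// /S -sumrB.
rewrite (big_cat_nat n1 (ltnW nM))/= big_nat big1 ?add0r; last first.
  by move=> k /eq_lt ek; rewrite /digit ek subrr.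
rewrite big_ltn//; apply: lerD.
  have my : (cantor_digit m n y < m n)%N by rewrite ltn_mod m_gt0.
  have := @term_gap n ((m n).-1 - cantor_digit m n y) ((m n).-1 - cantor_digit m n x) n1.
  rewrite (_ : ((m n).-1 - cantor_digit m n x - ((m n).-1 - cantor_digit m n y) =
    cantor_digit m n y - cantor_digit m n x)%N); last by lia.
  by apply; lia.
rewrite lerNl -sumrN; apply: le_trans (sum_w_tail M (ltn0Sn n)).
apply: ler_sum_nat => k /andP[nk _]; have k1 : (1 <= k)%N by lia.
have := term_bounds k1 (dig1 x _ k1); have := term_bounds k1 (dig1 y _ k1); lra.
Unshelve. all: by end_near. Qed.

(** Digits can differ only at a level with m_n >= 2, so the last two estimates are asked at such
    levels only. *)
Hypotheses (t C : R) (n0 : nat) (t0 : 0 < t) (t1 : t <= 1) (C0 : 0 < C)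
  (m_ge2 : forall n, (n0 <= n)%N -> (2 <= m n)%N)
  (G_ge : forall n, (1 <= n)%N -> (2 <= m n)%N -> 4 * w n.+1 <= G n)
  (m_prod : forall n, (1 <= n)%N -> (2 <= m n)%N ->
     (cantor_base m n.-1)%:R^-1 <= C * ((m n)%:R * G n) `^ t).

Lemma cantor_base_unbounded (B : nat) : exists n, (B <= cantor_base m n)%N.
Proof.
(* The B factors after level [n0] are at least 2, and 2^B > B. *)
exists (n0 + B)%N; apply: (leq_trans (ltnW (ltn_expl B (ltnSn 1)))).
elim: B => [|B IH]; first by rewrite cantor_base_gt0//; exact: m_gt0.
rewrite addnS cantor_baseS expnSr leq_mul// m_ge2//; lia.
Qed.

Lemma phi_holder (x y : R) : 0 <= x -> x < y -> y < 1 ->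
  y - x <= 2 * C * 2 `^ t * `|phi y - phi x| `^ t.
Proof.
move=> x0 xy y1.
have [n [eqd ltd dist]] := cantor_first_difference m_gt0 cantor_base_unbounded x0 xy y1.
have dy : (cantor_digit m n.+1 y < m n.+1)%N by rewrite ltn_mod m_gt0.
have mn2 : (2 <= m n.+1)%N by lia.
have gap := phi_gap (ltn0Sn n) eqd ltd.
have G4 := G_ge (ltn0Sn n) mn2; have mp := m_prod (ltn0Sn n) mn2.
move: gap dist; set K := (_ - _)%N => gap dist.
have K1 : 1 <= K%:R :> R by rewrite ler1n subn_gt0.
have Km : K%:R <= (m n.+1)%:R :> R by rewrite ler_nat (leq_trans (leq_subr _ _) (ltnW dy)).
have G0 : 0 <= G n.+1 by rewrite invr_ge0 mulr_ge0 ?exprn_ge0.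
have P0 : 0 < (cantor_base m n)%:R :> R by rewrite ltr0n cantor_base_gt0//; exact: m_gt0.
have m0 : 0 < (m n.+1)%:R :> R by lra.
(* By [G4] and K >= 1 the tail takes at most half of the gap. *)
have KG : K%:R * G n.+1 <= 2 * (phi y - phi x).
  have : G n.+1 <= K%:R * G n.+1 by rewrite ler_peMl.
  lra.
pose u := K%:R / (m n.+1)%:R : R.
have u0 : 0 < u by rewrite divr_gt0//; lra.
have uut : u <= u `^ t by apply: ger1_powR => //; rewrite u0 ler_pdivrMr// mul1r.
have -> : 2 * C * 2 `^ t * `|phi y - phi x| `^ t =
    2 * (C * (2 * `|phi y - phi x|) `^ t) by rewrite powRM//; ring.
have d1 : y - x <= 2 * (u * (cantor_base m n)%:R^-1).
  rewrite (_ : 2 * _ = 2 * K%:R / ((cantor_base m n)%:R * (m n.+1)%:R)); last first.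
    by rewrite /u; field; rewrite !gt_eqF.
  by rewrite ler_pdivlMr ?mulr_gt0// mulrC -natrM -cantor_baseS.
apply: (le_trans d1); rewrite ler_pM2l//.
(* Once u is replaced by u^t, the two powers merge, since u times m_(n+1) G_(n+1) is K G_(n+1). *)
apply: (@le_trans _ _ (u `^ t * (C * ((m n.+1)%:R * G n.+1) `^ t))).
  by apply: ler_pM => //; rewrite ?invr_ge0 ltW.
have mG0 : 0 <= (m n.+1)%:R * G n.+1 by rewrite mulr_ge0.
rewrite mulrCA ler_pM2l// -powRM ?(ltW u0)//.
apply: ge0_ler_powR; rewrite ?nnegrE; first exact: ltW.
- by rewrite mulr_ge0// ltW.
- by rewrite mulr_ge0.
- by rewrite mulrA divfK ?gt_eqF// (le_trans KG)// ler_pM2l// ler_norm.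
Qed.

(** The superset [E] leaves room to trim the digit sets before coding. *)
Lemma hausdorff_dim_digit_sums_ge (E : set R) :
  (digit_sums a D `<=` E)%classic -> (t%:E <= hausdorff_dim E)%E.
Proof.
move=> DE; apply: (@hausdorff_dim_ge_holder _ _ phi t (2 * C * 2 `^ t)).
- by rewrite !mulr_gt0// powR_gt0.
- by move=> x _; apply: DE; exact: phi_digit_sums.
- exact: phi_holder.
Qed.

End DigitSums.

(** * Comparison of growth rates *)

Lemma exprn_dominated (R : realType) (eta c : R) :
  0 < eta -> eta < 1 -> 0 < c ->
  exists n0, forall n, (n0 <= n)%N -> 2 * (2 - eta) ^+ n + n%:R + 2 <= c * 2 ^+ n.
Proof.
move=> eta0 eta1 c0; pose x := 1 - eta; have x0 : 0 < x by rewrite /x; lra.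
have bern n : n%:R * x + 1 <= (2 - eta) ^+ n.
  elim: n => [|n IH]; first by rewrite mul0r add0r expr0.
  rewrite exprSr -natr1; have nx : 0 <= n%:R * x by rewrite mulr_ge0// ltW.
  have -> : 2 - eta = 1 + x by rewrite /x; lra.
  have : (n%:R * x + 1) * (1 + x) <= (1 + x) ^+ n * (1 + x).
    by rewrite ler_wpM2r//; [lra|]; rewrite (_ : 1 + x = 2 - eta)// /x; lra.
  apply: le_trans; have : 0 <= n%:R * x * x by rewrite mulr_ge0// ltW.
  lra.
(* With e = (2 - eta)^n, [bern] gives e >= 1 and n <= e / x, so the left side is at most 2 e + e / x
   + 2 e = K e, while e / 2^n tends to 0. *)
pose K := 4 + x^-1; have xi0 : 0 < x^-1 by rewrite invr_gt0.
have K0 : 0 < K by rewrite /K; lra.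
have q1 : `|(2 - eta) / 2| < 1 by rewrite ltr_norml; apply/andP; split; lra.
have /cvgrPdist_le/(_ (c / K)) := cvg_expr q1.
rewrite divr_gt0// => /(_ isT)[n0 _ Hn0]; exists n0 => n /Hn0 /=.
rewrite sub0r normrN => /(le_trans (ler_norm _)).
rewrite expr_div_n ler_pdivrMr ?exprn_gt0// mulrAC ler_pdivlMr// => le_c.
have := bern n; set e := (2 - eta) ^+ n in le_c * => bn.
have e1 : 1 <= e by apply: le_trans bn; rewrite lerDr mulr_ge0// ltW.
have : x^-1 * (n%:R * x + 1) <= x^-1 * e by rewrite ler_pM2l.
rewrite mulrDr mulrCA mulVf ?gt_eqF// !mulr1 => ne.
apply: le_trans le_c; rewrite /K; lra.
Qed.

(** * Choice of parameters and exponent estimates *)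

Unset Implicit Arguments.
Set Strict Implicit.

Theorem theorem4 (R : realType) (N : nat) (s r eta : R)
    (f g h a m : nat -> nat) (D : nat -> seq nat)
    (hN : (2 <= N)%N)
    (hs : 0 < s) (hsr : s <= r) (hr : r < 1 / 2)
    (heta0 : 0 < eta) (heta1 : eta < 1)
    (hlow : forall n : nat, (1 <= n)%N ->
      [/\ (1 <= f n)%N,
          1 <= ((g n)%:R : R) `^ (1 / s)
        & 1 <= ((h n)%:R : R) `^ (1 / r)])
    (hup : forall n : nat, (1 <= n)%N ->
      [/\ (f n)%:R <= N%:R `^ ((2 - eta) ^+ n),
          (g n)%:R `^ (1 / s) <= N%:R `^ ((2 - eta) ^+ n)
        & (h n)%:R `^ (1 / r) <= N%:R `^ ((2 - eta) ^+ n)])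
    (hgh : forall n : nat, (1 <= n)%N ->
      N%:R `^ (s * 2 ^+ n) * (g n)%:R <= N%:R `^ (r * 2 ^+ n) * (h n)%:R)
    (ha : forall n : nat, (1 <= n)%N -> a n = (N ^ (2 ^ n) * f n)%N)
    (hm : forall n : nat, (1 <= n)%N ->
      (m n)%:Z = Num.floor (N%:R `^ (s * 2 ^+ n) * (g n)%:R))
    (hD : forall n : nat, (1 <= n)%N ->
      [/\ sorted ltn (D n),
          size (D n) = m n,
          head 0%N (D n) = 1%N
        & (last 0%N (D n))%:R <= N%:R `^ (r * 2 ^+ n) * (h n)%:R]) :
  ((s / (2 - s))%:E <= hausdorff_dim (digit_sums a D))%E.
Proof.
pose X (z : R) := N%:R `^ z.
have A2 : 2 <= N%:R :> R by rewrite ler_nat.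
have A0 : N%:R != 0 :> R by rewrite gt_eqF// (lt_le_trans _ A2).
have X0 z : 0 < X z by rewrite powR_gt0//; lra.
have XD y z : X (y + z) = X y * X z by rewrite /X powRD// A0 implybT.
have Xle y z : y <= z -> X y <= X z by apply: ler_powR; lra.
have XN z : X (- z) = (X z)^-1 by rewrite /X powRN.
have XX y z : X y `^ z = X (y * z) by rewrite /X powRrM.
have X1 : 2 <= X 1 by rewrite /X powRr1//; lra.
have X00 : X 0 = 1 by rewrite /X powRr0.
pose e n : R := (2 - eta) ^+ n.
have e0 n : 0 <= e n by rewrite exprn_ge0//; lra.
pose t := s / (2 - s); have s2 : 0 < 2 - s by lra.
have tE : t * (2 - s) = s by rewrite divfK// gt_eqF.
have t0 : 0 < t by rewrite divr_gt0.
have t1 : t <= 1 by rewrite ler_pdivrMr//; lra.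
have ts : t <= s by rewrite ler_pdivrMr//; nra.
(* The slack: s = t (2 - s) = c + t (1 + 2 r - s), with c > 0 as r < 1/2. Through [cs] and [cr] a
   single [n0] serves all the estimates. *)
pose c := t * (1 - 2 * r).
have c0 : 0 < c by rewrite mulr_gt0//; lra.
have cs : c <= s by rewrite /c; nra.
have cr : c <= 1 - 2 * r by rewrite /c; nra.
have [n0 Hn0] := exprn_dominated heta0 heta1 c0.
have h2n n : 1 <= 2 ^+ n :> R by rewrite exprn_ege1// ler1n.
(* k = 0 is excluded because 0 to a positive power is 0. *)
have natr_ge1 (k : nat) (z : R) : 0 < z -> 1 <= (k%:R : R) `^ (1 / z) -> 1 <= k%:R :> R.
  move=> z0; case: k => [|k _]; last by rewrite ler1n.
  by rewrite powR0 ?ler10// gt_eqF// divr_gt0.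
have m_gt n : (1 <= n)%N -> X (s * 2 ^+ n) < (m n)%:R + 1.
  move=> n1; have [_ /(natr_ge1 _ _ hs) g1 _] := hlow n n1.
  have := floorD1_gt (N%:R `^ (s * 2 ^+ n) * (g n)%:R); rewrite -hm// intrD.
  by apply: le_lt_trans; rewrite ler_peMr// ltW.
have m_pos n : (1 <= n)%N -> (0 < m n)%N.
  move=> n1; rewrite -(ltr_nat R).
  have := m_gt n n1; have := Xle 0 (s * 2 ^+ n) (mulr_ge0 (ltW hs) (exprn_ge0 n (ler0n R 2))).
  rewrite X00; lra.
(* Rounding down costs at most a factor N: N^(s 2^n) < m_n + 1 <= 2 m_n <= N m_n. *)
have m_ge n : (1 <= n)%N -> X (s * 2 ^+ n - 1) <= (m n)%:R.
  move=> n1; rewrite XD XN ler_pdivrMr//.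
  have := m_gt n n1; have : 1 <= (m n)%:R :> R by rewrite ler1n m_pos.
  nra.
have a_eq n : (1 <= n)%N -> (a n)%:R = X (2 ^+ n) * (f n)%:R.
  by move=> n1; rewrite ha// natrM natrX /X -powR_mulrn// natrX.
have a_ge n : (1 <= n)%N -> X (2 ^+ n) <= (a n)%:R.
  by move=> n1; rewrite a_eq// ler_peMr ?(ltW (X0 _))// ler1n; case: (hlow n n1).
have a_le n : (1 <= n)%N -> (a n)%:R <= X (2 ^+ n + e n).
  by move=> n1; rewrite a_eq// XD ler_wpM2l ?(ltW (X0 _))//; case: (hup n n1).
have last_le n : (1 <= n)%N -> (last 0%N (D n))%:R <= X (r * 2 ^+ n + r * e n).
  move=> n1; have [_ _ _ /le_trans->//] := hD n n1.
  rewrite XD ler_wpM2l ?(ltW (X0 _))//.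
  have [_ _ hle] := hup n n1; have r0 : 0 < r by lra.
  rewrite (_ : (h n)%:R = ((h n)%:R `^ (1 / r)) `^ r); last first.
    by rewrite -powRrM divfK ?gt_eqF// powRr1.
  by rewrite /X (mulrC r) [leRHS]powRrM ge0_ler_powR ?nnegrE ?powR_ge0// ltW.
have G_ge n : (1 <= n)%N ->
    X (- ((1 + 2 * r) * 2 ^+ n + (1 + 2 * r) * e n)) <=
    ((last 0%N (D n))%:R ^+ 2 * (a n)%:R)^-1.
  move=> n1; have a0 := lt_le_trans (X0 _) (a_ge n n1).
  have l0 : 0 < (last 0%N (D n))%:R :> R.
    have [+ sz hd _] := hD n n1; have := m_pos n n1; rewrite -sz.
    case: (D n) hd => //= d l -> _ /(order_path_min ltn_trans)/allP lt1.
    rewrite ltr0n; have := mem_last 1%N l; rewrite inE => /predU1P[->//|/lt1].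
    exact: ltn_trans.
  rewrite XN lef_pV2 ?posrE ?mulr_gt0 ?exprn_gt0//.
  rewrite (_ : _ + _ = (r * 2 ^+ n + r * e n) + (r * 2 ^+ n + r * e n) + (2 ^+ n + e n)); last by ring.
  rewrite XD XD.
  apply: ler_pM; rewrite ?mulr_ge0 ?exprn_ge0 ?a_le// expr2.
  by apply: ler_pM; rewrite ?last_le.
(* Below [n0], where the estimates may fail, the digit is frozen at 1; this only shrinks the set of
   sums. *)
pose D' n := if (n < n0)%N then [:: 1%N] else D n.
pose w n := X (- 2 ^+ n).
have size_D' n : (1 <= n)%N -> (n0 <= n)%N -> size (D' n) = m n.
  by move=> n1 nn0; rewrite /D' ltnNge nn0 /=; case: (hD n n1).
have n0_le n : (2 <= size (D' n))%N -> (n0 <= n)%N.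
  by rewrite /D'; case: (ltnP n n0).
(* A geometric sum of the exponents s 2^k, less 1 per level for rounding. Up to level [n0] the
   exponent is nonpositive and the base at least 1. *)
have base_ge n : X (s * 2 ^+ n.+1 - s * 2 ^+ n0.+1 - n%:R) <=
    (cantor_base (fun k => size (D' k)) n)%:R.
  have D'0 k : (1 <= k)%N -> (0 < size (D' k))%N.
    by move=> k1; rewrite /D'; case: ifP => // _; have [_ -> _ _] := hD k k1; exact: m_pos.
  have small k : (k <= n0)%N -> X (s * 2 ^+ k.+1 - s * 2 ^+ n0.+1 - k%:R) <=
      (cantor_base (fun k => size (D' k)) k)%:R.
    move=> kn0; apply: (@le_trans _ _ (X 0)).
      apply: Xle; have : s * 2 ^+ k.+1 <= s * 2 ^+ n0.+1.
        by rewrite ler_pM2l// ler_weXn2l ?ler1n.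
      have : 0 <= k%:R :> R by [].
      lra.
    by rewrite X00 ler1n cantor_base_gt0.
  elim: n => [|n IH]; first exact: small.
  have [n0n|] := leqP n0 n.+1; last by move=> /ltnW; exact: small.
  rewrite cantor_baseS natrM size_D'// -natr1.
  rewrite (_ : _ - _ = (s * 2 ^+ n.+1 - s * 2 ^+ n0.+1 - n%:R) + (s * 2 ^+ n.+1 - 1)); last first.
    by rewrite [2 ^+ n.+2]exprS; ring.
  by rewrite XD; apply: ler_pM; [exact: ltW|exact: ltW|exact: IH|exact: m_ge].
apply: (@hausdorff_dim_digit_sums_ge R a D' w _ _ _ _ _ t (X (s * 2 ^+ n0.+1 + t)) n0.+1) => //.
- move=> n n1; rewrite -(ltr_nat R); exact: lt_le_trans (X0 _) (a_ge n n1).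
- move=> n n1; rewrite /w XN lef_pV2 ?posrE ?a_ge//.
  exact: lt_le_trans (X0 _) (a_ge n n1).
- move=> n _; rewrite /w; apply: (@le_trans _ _ (X 1 * X (- 2 ^+ n.+1))).
    by rewrite ler_pM2r.
  by rewrite -XD; apply: Xle; rewrite exprS; have := h2n n; lra.
- by move=> n n1; rewrite /D'; case: ifP => // _; case: (hD n n1).
- by move=> n n1; rewrite /D'; case: ifP => // _; case: (hD n n1).
- move=> n n0n; have n1 : (1 <= n)%N by exact: leq_trans n0n.
  rewrite size_D' ?(ltnW n0n)//.
  rewrite -(ler_nat R); apply: le_trans (m_ge n n1); apply: le_trans X1 _.
  apply: Xle; have := Hn0 n (ltnW n0n); have := e0 n; rewrite -/(e n).
  have : c * 2 ^+ n <= s * 2 ^+ n by rewrite ler_wpM2r// exprn_ge0.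
  have : 0 <= n%:R :> R by [].
  lra.
- move=> n n1 /n0_le n0n; rewrite /w /D' ltnNge n0n /=.
  apply: le_trans (G_ge n n1).
  (* As 4 <= N^2, it remains to see 2 + (1 + 2 r) (2 - eta)^n <= (1 - 2 r) 2^n. *)
  apply: (@le_trans _ _ (X 1 * X 1 * X (- 2 ^+ n.+1))).
    rewrite ler_pM2r//; nra.
  rewrite -!XD; apply: Xle; rewrite exprS.
  have := Hn0 n n0n; have := e0 n; rewrite -/(e n).
  have : c * 2 ^+ n <= (1 - 2 * r) * 2 ^+ n by rewrite ler_wpM2r// exprn_ge0.
  have : 2 * r * e n <= 1 * e n by rewrite ler_wpM2r//; lra.
  have : 0 <= n%:R :> R by [].
  lra.
- case=> // n n1 /n0_le n0n; rewrite size_D'// /D' ltnNge n0n /=.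
  apply: (@le_trans _ _ (X (- (s * 2 ^+ n.+1 - s * 2 ^+ n0.+1 - n%:R)))).
    by rewrite XN lef_pV2 ?posrE ?base_ge// (lt_le_trans _ (base_ge n)).
  apply: (@le_trans _ _ (X (s * 2 ^+ n0.+1 + t) *
    (X (s * 2 ^+ n.+1 - 1 - ((1 + 2 * r) * 2 ^+ n.+1 + (1 + 2 * r) * e n.+1)) `^ t))); last first.
    rewrite ler_pM2l// ge0_ler_powR ?nnegrE ?(ltW t0) ?(ltW (X0 _)) ?mulr_ge0 ?invr_ge0 ?exprn_ge0//.
    by rewrite XD; apply: ler_pM; [exact: ltW|exact: ltW|exact: m_ge|exact: G_ge].
  rewrite XX -XD; apply: Xle.
  (* After cancellation, n + t (1 + 2 r) (2 - eta)^(n+1) <= c 2^(n+1) remains. *)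
  have := Hn0 n.+1 n0n; rewrite -/(e n.+1) -natr1.
  have : t * (1 + 2 * r) * e n.+1 <= 2 * e n.+1 by rewrite ler_wpM2r//; nra.
  have : s * 2 ^+ n.+1 = c * 2 ^+ n.+1 + t * (1 + 2 * r - s) * 2 ^+ n.+1.
    by rewrite -{1}tE /c; ring.
  rewrite !mulrDr !mulrDl; lra.
(* Trimmed sums are sums over [D], since each D_n contains 1. *)
move=> _ [d dD' <-]; exists d => //= n n1; have := dD' n n1; rewrite /D'.
case: ifP => // _; rewrite inE => /eqP->.
have [_ sz hd _] := hD n n1; have := m_pos n n1; rewrite -sz.
by case: (D n) hd => //= ? ? -> _; rewrite mem_head.
Qed.
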